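(* Let $m$ be a squarefree positive integer, let $\mathcal O$ be an order in the ring of integers $\mathcal O_{-m}$ of the imaginary quadratic field $\mathbb Q(i\sqrt m)$, and let $\mathcal I$ be a non-zero ideal of $\mathcal O$. For every $x\in\mathbb C-\mathbb Q(i\sqrt m)$, let $$c(x)=\liminf_{(p,q)\in\mathcal O\times\mathcal I,\ \langle p,q\rangle=\mathcal O,\ |q|\to\infty}|q|^2\left|x-\frac pq\right|,$$ and let $\mathrm{Sp}_{\mathrm{Lag}}$ be the set of real numbers of the form $c(x)$ for some $x\in\mathbb C-\mathbb Q(i\sqrt m)$. Then $\mathrm{Sp}_{\mathrm{Lag}}$ contains the interval $[0,0.033]$.
   Context: An order in $\mathbb Q(i\sqrt m)$ is a unitary subring of $\mathcal O_{-m}$ which is a free $\mathbb Z$-module of rank $2$. $\langle p,q\rangle$ denotes the ideal of $\mathcal O$ generated by $p$ and $q$. *)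

(* Defs.v *)
From HB Require Import structures.
From mathcomp Require Import all_boot all_order all_algebra.
From mathcomp Require Import complex.
From mathcomp Require Import classical_sets reals constructive_ereal ereal.
Unset Printing Implicit Defensive.
Import Order.TTheory GRing.Theory Num.Theory.
Local Open Scope ring_scope.
Local Open Scope classical_set_scope.

Definition squarefree (m : nat) : Prop := forall d : nat, (1 < d)%N -> ~~ (d * d %| m)%N.

Definition isqrt (R : realType) (m : nat) : R[i] := (0 +i* Num.sqrt (m%:R : R))%C.

Definition QF (R : realType) (m : nat) : set R[i] :=
  [set z | exists a b : rat, z = ratr a + ratr b * isqrt R m].

Definition OK (R : realType) (m : nat) : set R[i] :=
  [set z | QF R m z /\ exists p : {poly int},
      p \is monic /\ root (map_poly (fun k : int => k%:~R : R[i]) p) z].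

Definition is_order (R : realType) (m : nat) (O : set R[i]) : Prop :=
  [/\ O `<=` OK R m, O 1,
      (forall x y, O x -> O y -> O (x - y)),
      (forall x y, O x -> O y -> O (x * y)) &
      exists e1 e2 : R[i],
        (forall z, O z <-> exists a b : int, z = a%:~R * e1 + b%:~R * e2) /\
        (forall a b : int, a%:~R * e1 + b%:~R * e2 = 0 -> a = 0 /\ b = 0)].

Definition is_ideal (R : realType) (O I : set R[i]) : Prop :=
  [/\ I `<=` O, I 0,
      (forall x y, I x -> I y -> I (x + y)) &
      (forall a x, O a -> I x -> I (a * x))].

Definition gen_whole (R : realType) (O : set R[i]) (p q : R[i]) : Prop :=
  forall z, O z <-> exists u v, O u /\ O v /\ z = u * p + v * q.

Definition lag_c (R : realType) (O I : set R[i]) (x : R[i]) : \bar R :=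
  ereal_sup [set ereal_inf
              [set y | exists p q : R[i], [/\ O p, I q, gen_whole R O p q,
                         r <= @Normc.normc R q & y = ((@Normc.normc R q) ^+ 2 * @Normc.normc R (x - p / q))%:E]]
            | r in [set: R]].

Definition SpLag (R : realType) (m : nat) (O I : set R[i]) : set R :=
  [set t | exists x : R[i], ~ QF R m x /\ lag_c R O I x = t%:E].

(* Main.v *)
(* Write f_s(x) = |q|^2 |x - p/q| for a fraction s = p/q. Nonzero elements of O have
   modulus at least 1, so two fractions are at distance at least 1/|q q'|; together with
   density this separation is all that is used.
   Given a fraction r and 0 < t <= 1/30, a nested-interval argument on the circle f_r = t
   yields x with f_r(x) = t and f_s(x) >= 1/26 for all s of denominator at least
   |q_r| / (2t). Conversely, arbitrarily close to such an x there is a fraction r' with large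
   denominator and f_s(r') >= 1/29 for all other s of denominator at least |q_r| / (2t):
   start from any nearby fraction and, as long as some s violates the bound, jump to it.
   The points of the circle f_r' = t' are so close to r' that f_s stays above 2/59 > 1/30
   on it, for the s <> r' of denominator up to |q_r'| / (2t'). Alternating the two steps with
   t' > 0 decreasing to the prescribed t < 1/30 gives a convergent sequence, whose limit x
   has liminf f_s(x) = t. *)
Require Import Defs.
From HB Require Import structures.
From mathcomp Require Import all_boot all_order all_algebra.
From mathcomp Require Import complex ring lra.
From mathcomp Require Import boolp classical_sets reals constructive_ereal ereal.
Set Implicit Arguments.
Unset Strict Implicit.
Import Order.TTheory GRing.Theory Num.Theory.
Local Open Scope ring_scope.
Local Open Scope classical_set_scope.

Local Notation N := (@Normc.normc _).

(** * Modulus on the complex numbers and limits of geometrically convergent sequences *)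

Section ComplexNorm.
Variable R : realType.
Implicit Types x y z : R[i].

Lemma normcD x y : N (x + y) <= N x + N y.
Proof. exact: (@le_normcD R). Qed.

Lemma normcNE x : N (- x) = N x.
Proof. exact: (@normcN R). Qed.

Lemma normcBC x y : N (x - y) = N (y - x).
Proof. by rewrite -normcNE opprB. Qed.

Lemma normc_ge0 x : 0 <= N x.
Proof. by case: x => a b; rewrite /Normc.normc sqrtr_ge0. Qed.

Lemma normc_dist z x y : N (x - y) <= N (x - z) + N (z - y).
Proof. by rewrite -[x - y](subrKA z) normcD. Qed.

Lemma normc_gt0 x : (0 < N x) = (x != 0).
Proof.
rewrite lt_neqAle normc_ge0 andbT eq_sym; congr (~~ _).
by apply/eqP/eqP => [/Normc.eq0_normc|->]; rewrite ?Normc.normc0.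
Qed.

Lemma normc_real (a : R) : N (a%:C)%C = `|a|.
Proof. by rewrite /Normc.normc /= expr0n addr0 sqrtr_sqr. Qed.

Lemma normcX x n : N (x ^+ n) = N x ^+ n.
Proof.
elim: n => [|n IH]; first by rewrite !expr0 Normc.normc1.
by rewrite !exprS Normc.normcM IH.
Qed.

Lemma normc_le_ReIm x : N x <= `|complex.Re x| + `|complex.Im x|.
Proof.
case: x => a b /=; rewrite -(@ler_pXn2r _ 2) ?nnegrE ?sqrtr_ge0 ?addr_ge0 //.
rewrite sqr_sqrtr ?addr_ge0 ?sqr_ge0 // sqrrD !real_normK ?num_real // lerD2r.
by rewrite lerDl mulrn_wge0 // mulr_ge0.
Qed.

Lemma normc_ge_absRe x : `|complex.Re x| <= N x.
Proof.
by case: x => a b /=; rewrite -sqrtr_sqr ler_wsqrtr // lerDl sqr_ge0.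
Qed.

Lemma normc_ge_absIm x : `|complex.Im x| <= N x.
Proof.
by case: x => a b /=; rewrite -sqrtr_sqr ler_wsqrtr // lerDr sqr_ge0.
Qed.

Lemma nested_intervals (a b : nat -> R) :
  (forall n, a n <= a n.+1) -> (forall n, b n.+1 <= b n) ->
  (forall n, a n <= b n) -> exists t, forall n, a n <= t <= b n.
Proof.
move=> ha hb hab.
have a_mono : {homo a : m n / (m <= n)%N >-> m <= n} by apply: homo_leq => //; exact: le_trans.
have b_mono : {homo b : m n / (m <= n)%N >-> n <= m}.
  by apply: homo_leq => // x y z h1 h2; exact: le_trans h2 h1.
have ab m n : a m <= b n.
  apply: le_trans (a_mono _ _ (leq_maxl m n)) _.
  exact: le_trans (hab _) (b_mono _ _ (leq_maxr m n)).
have ubE n : ubound [set a m | m in [set: nat]] (b n) by move=> _ [m _ <-].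
exists (sup [set a m | m in [set: nat]]) => n; apply/andP; split.
  by apply: ub_le_sup; [exists (b 0%N); exact: ubE|exists n].
by apply: ge_sup; [exists (a 0%N); exists 0%N|exact: ubE].
Qed.

(** The intervals of radius [2 * d n] around [x n] are nested, because
    [d n + 2 * d n.+1 <= 2 * d n]. *)
Lemma real_limit (x d : nat -> R) :
  (forall n, `|x n.+1 - x n| <= d n) -> (forall n, d n.+1 <= d n / 2) ->
  exists t, forall n, `|t - x n| <= 2 * d n.
Proof.
move=> hx hd.
have d0 n : 0 <= d n by exact: le_trans (hx n).
have [t ht] : exists t, forall n, x n - 2 * d n <= t <= x n + 2 * d n.
  apply: nested_intervals => n; move: (hx n) (hd n) (d0 n); rewrite ?ler_norml; lra.
by exists t => n; move: (ht n); rewrite ler_norml; lra.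
Qed.

Lemma complex_limit (x : nat -> R[i]) (d : nat -> R) :
  (forall n, N (x n.+1 - x n) <= d n) -> (forall n, d n.+1 <= d n / 2) ->
  exists z, forall n, N (z - x n) <= 4 * d n.
Proof.
move=> hx hd.
have [a ha] : exists a, forall n, `|a - complex.Re (x n)| <= 2 * d n.
  apply: real_limit => // n; apply: le_trans (hx n).
  by have := normc_ge_absRe (x n.+1 - x n); case: (x n.+1) (x n) => [? ?] [].
have [b hb] : exists b, forall n, `|b - complex.Im (x n)| <= 2 * d n.
  apply: real_limit => // n; apply: le_trans (hx n).
  by have := normc_ge_absIm (x n.+1 - x n); case: (x n.+1) (x n) => [? ?] [].
exists (a +i* b)%C => n; apply: le_trans (normc_le_ReIm _) _.
have -> : 4 * d n = 2 * d n + 2 * d n by lra.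
by apply: lerD; [move: (ha n)|move: (hb n)]; case: (x n).
Qed.

End ComplexNorm.

(** * Approximation by a separated dense family of weighted points *)

Section SeparatedFamily.
Variables (R : realType) (T : Type) (pt : T -> R[i]) (den : T -> R).
Hypothesis den_ge1 : forall s, 1 <= den s.
Hypothesis pt_sep : forall s s',
  pt s <> pt s' -> 1 <= den s * den s' * N (pt s - pt s').
Hypothesis den_uniq : forall s s', pt s = pt s' -> den s = den s'.
Hypothesis pt_dense : forall x d q, 0 < d ->
  exists2 s, q <= den s & N (x - pt s) <= d.

Local Notation app s x := (den s ^+ 2 * N (x - pt s)).

Let den_gt0 s : 0 < den s.
Proof. exact: lt_le_trans (den_ge1 s). Qed.

(* At scale Q the points of denominator in [Q, 2Q[ close to the arc have at most one
   location, so either the first or the last quarter of the arc avoids them. *)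
Lemma avoid_stage (g : R -> R[i]) (A L Q a l : R) :
  0 < A -> 0 < Q -> A * l * Q ^+ 2 = 9 / 52 -> 0 <= a -> a + l <= L ->
  (forall y y', 0 <= y <= L -> 0 <= y' <= L ->
     9 / 10 * A * `|y - y'| <= N (g y - g y') <= A * `|y - y'|) ->
  exists a', [/\ a <= a', a' + l / 4 <= a + l & forall y s, a' <= y <= a' + l / 4 ->
     Q <= den s < 2 * Q -> 1 / 26 <= app s (g y)].
Proof.
move=> A0 Q0 hl a0 aL hg.
have l0 : 0 < l.
  have : 0 < A * l * Q ^+ 2 by rewrite hl; lra.
  by rewrite pmulr_lgt0 ?exprn_gt0 // pmulr_rgt0.
pose good a' := forall y s, a' <= y <= a' + l / 4 ->
     Q <= den s < 2 * Q -> 1 / 26 <= app s (g y).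
have bad a' : ~ good a' -> exists y s, [/\ a' <= y <= a' + l / 4,
    Q <= den s < 2 * Q & Q ^+ 2 * N (g y - pt s) < 1 / 26].
  move/existsNP => [y /existsNP [s /not_implyP [h1 /not_implyP [h2 /negP]]]].
  rewrite -ltNge => h3; exists y, s; split => //.
  apply: le_lt_trans h3; apply: ler_wpM2r; first exact: normc_ge0.
  by rewrite ler_pXn2r ?nnegrE ?(ltW Q0) ?(ltW (den_gt0 s)) //; case/andP: h2.
have [gl|/bad [y [s [hy hs hys]]]] := pselect (good a).
  by exists a; split; [lra|lra|exact: gl].
have [gr|/bad [y' [s' [hy' hs' hys']]]] := pselect (good (a + 3 / 4 * l)).
  by exists (a + 3 / 4 * l); split; [lra|lra|exact: gr].
(* The constant 9/52 excludes bad parameters in both outer quarters. For equal locations, [Q ^+ 2]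
   times the chord is at least 9/20 * 9/52 > 2/26; for distinct ones, separation would give 1 < 4 *
   (2/26 + 9/52) = 1. *)
exfalso.
have /andP[lo up] : 9 / 10 * A * `|y - y'| <= N (g y - g y') <= A * `|y - y'|.
  by apply: hg; lra.
have yy : l / 2 <= `|y - y'| <= l.
  rewrite distrC; have -> : `|y' - y| = y' - y by apply: ger0_norm; lra.
  lra.
have Q2 : 0 < Q ^+ 2 by rewrite exprn_gt0.
have [e|ne] := pselect (pt s = pt s').
  have h1 : Q ^+ 2 * (9 / 10 * A * (l / 2)) <= Q ^+ 2 * N (g y - g y').
    rewrite (ler_pM2l Q2); apply: le_trans lo; apply: ler_wpM2l; lra.
  have h2 : Q ^+ 2 * N (g y - g y') <= Q ^+ 2 * N (g y - pt s) + Q ^+ 2 * N (g y' - pt s').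
    rewrite -mulrDr (ler_pM2l Q2).
    by rewrite [N (g y' - _)]normcBC -e; exact: normc_dist.
  have h3 : Q ^+ 2 * (9 / 10 * A * (l / 2)) = 9 / 20 * (A * l * Q ^+ 2) by field.
  lra.
have h1 : Q ^+ 2 * N (pt s - pt s') <= Q ^+ 2 * N (g y - pt s) + Q ^+ 2 * N (g y - g y')
    + Q ^+ 2 * N (g y' - pt s').
  rewrite -!mulrDr (ler_pM2l Q2).
  apply: le_trans (normc_dist (g y') _ _) _; rewrite lerD2r.
  by apply: le_trans (normc_dist (g y) _ _) _; rewrite lerD2r normcBC.
have h2 : Q ^+ 2 * N (g y - g y') <= 9 / 52.
  rewrite -hl [leRHS]mulrC; rewrite (ler_pM2l Q2).
  apply: le_trans up _; apply: ler_wpM2l; lra.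
have h3 : den s * den s' * N (pt s - pt s') <= 4 * (Q ^+ 2 * N (pt s - pt s')).
  rewrite mulrA; apply: ler_wpM2r; first exact: normc_ge0.
  have -> : 4 * Q ^+ 2 = (2 * Q) * (2 * Q) by ring.
  by apply: ler_pM; rewrite ?(ltW (den_gt0 _)) //; lra.
have := pt_sep ne; lra.
Qed.

Lemma dyadic_scale (q x : R) : 0 < q -> q <= x ->
  exists n, 2 ^+ n * q <= x < 2 ^+ n.+1 * q.
Proof.
move=> q0 qx.
have [k hk] : exists k : nat, x < 2 ^+ k * q.
  exists (Num.truncn (x / q)).+1; rewrite -ltr_pdivrMr //.
  apply: lt_trans (truncnS_gt _) _.
  by rewrite -natrX ltr_nat ltn_expl.
have [n nx nmin] := ex_minnP (ex_intro (fun k => x < 2 ^+ k * q) k hk).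
case: n nx nmin => [|n] nx nmin; first by move: nx; rewrite expr0 mul1r ltNge qx.
exists n; rewrite nx andbT leNgt; apply/negP => /nmin.
by rewrite ltnn.
Qed.

(** Stage [n] treats the denominators between [2 ^+ n * Q] and [2 ^+ n.+1 * Q]. Quartering the
    interval while doubling the scale preserves the product 9/52, so [avoid_stage] applies at every
    stage; a common point of the nested intervals is good for all of them. *)
Lemma avoid_on_arc (g : R -> R[i]) (A L Q : R) :
  0 < A -> 0 < Q -> A * L * Q ^+ 2 = 9 / 52 ->
  (forall y y', 0 <= y <= L -> 0 <= y' <= L ->
     9 / 10 * A * `|y - y'| <= N (g y - g y') <= A * `|y - y'|) ->
  exists2 y, 0 <= y <= L & forall s, Q <= den s -> 1 / 26 <= app s (g y).
Proof.
move=> A0 Q0 hL hg.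
have L0 : 0 < L.
  have : 0 < A * L * Q ^+ 2 by rewrite hL; lra.
  by rewrite pmulr_lgt0 ?exprn_gt0 // pmulr_rgt0.
pose l n : R := L / 4 ^+ n.
have lS n : l n.+1 = l n / 4 by rewrite /l exprS; field; rewrite expf_neq0 //; lra.
have l0 n : 0 < l n by rewrite divr_gt0 // exprn_gt0 //; lra.
(* The validity of the interval is a premise of the relation, which makes it total and lets choice
   yield a function. *)
pose stage (na : nat * R) a' := 0 <= na.2 -> na.2 + l na.1 <= L ->
    [/\ na.2 <= a', a' + l na.1 / 4 <= na.2 + l na.1 &
    forall y s, a' <= y <= a' + l na.1 / 4 ->
     2 ^+ na.1 * Q <= den s < 2 ^+ na.1.+1 * Q -> 1 / 26 <= app s (g y)].
have [f hf] : {f & forall na, stage na (f na)}.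
  apply: choice => -[n a]; rewrite /stage /=.
  have [[a0 aL]|nh] := pselect (0 <= a /\ a + l n <= L); last first.
    by exists 0 => a0 aL; case: nh.
  have : exists a', [/\ a <= a', a' + l n / 4 <= a + l n &
      forall y s, a' <= y <= a' + l n / 4 ->
      2 ^+ n * Q <= den s < 2 * (2 ^+ n * Q) -> 1 / 26 <= app s (g y)].
    apply: (@avoid_stage g A L) => //; first by rewrite mulr_gt0 ?exprn_gt0.
    rewrite -hL /l exprMn -exprM mulnC exprM.
    have -> : 2 ^+ 2 = 4 :> R by ring.
    by field; rewrite expf_neq0 //; lra.
  by case=> a' [h1 h2 h3]; exists a' => _ _; split=> // y s hy; rewrite exprS -mulrA; exact: h3.
pose a := fix a n := if n is n'.+1 then f (n', a n') else 0.
have ha n : 0 <= a n /\ a n + l n <= L.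
  elim: n => [|n [h1 h2]]; first by rewrite /= /l expr0 divr1 add0r.
  have [h3 h4 _] := hf (n, a n) h1 h2; move: h3 h4 => /= h3 h4.
  by rewrite lS; split; lra.
have hS n := hf (n, a n) (ha n).1 (ha n).2.
have [y hy] : exists y, forall n, a n <= y <= a n + l n.
  apply: nested_intervals => n; have := l0 n; have [/= h1 h2 _] := hS n; rewrite ?lS; lra.
exists y; first by have := hy 0%N; rewrite /= /l expr0; lra.
move=> s /(dyadic_scale Q0) [n hn].
have [_ _] := hS n; apply => //; by have := hy n.+1; rewrite lS.
Qed.

(* The circle is parametrised by the Cayley transform y |-> (1 + iy) / (1 - iy), whose
   chords have length 2 |y - y'| / (|1 - iy| |1 - iy'|). *)
Lemma avoid_on_circle r (t : R) : 0 < t <= 1 / 30 ->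
  exists2 x, app r x = t &
    forall s, den r / (2 * t) <= den s -> 1 / 26 <= app s x.
Proof.
move=> ht; have d0 := den_gt0 r.
pose rho := t / den r ^+ 2.
have rho0 : 0 < rho by apply: divr_gt0; [lra|exact: exprn_gt0].
pose D (y : R) : R[i] := (1 -i* y)%C.
pose h y := N (D y).
have h2 y : h y ^+ 2 = 1 + y ^+ 2.
  by rewrite /h /D /= sqr_sqrtr ?addr_ge0 ?sqr_ge0 // expr1n sqrrN.
have h1 y : 1 <= h y.
  rewrite -(@ler_pXn2r _ 2) ?nnegrE ?normc_ge0 // h2 expr1n.
  by rewrite lerDl sqr_ge0.
have D0 y : D y != 0 by rewrite -normc_gt0; have := h1 y; rewrite /h; lra.
pose cay y := (1 +i* y)%C / D y.
have cay1 y : N (cay y) = 1.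
  rewrite Normc.normcM Normc.normcV.
  have -> : N (1 +i* y)%C = N (D y) by rewrite /Normc.normc /D /= sqrrN.
  by rewrite divff // gt_eqF // normc_gt0.
have cayB y y' : N (cay y - cay y') = 2 * `|y - y'| / (h y * h y').
  have -> : cay y - cay y' = 2 * 'i%C * ((y - y')%:C)%C / (D y * D y').
    rewrite /cay; have -> : (1 +i* y)%C = 1 + 'i%C * (y%:C)%C by simpc.
    have -> : (1 +i* y')%C = 1 + 'i%C * (y'%:C)%C by simpc.
    have Dy z : D z = 1 - 'i%C * (z%:C)%C by rewrite /D; simpc.
    move: (D0 y) (D0 y'); rewrite !Dy => n1 n2.
    rewrite rmorphB /=.
    by field; rewrite n1 n2.
  rewrite Normc.normcM Normc.normcV !Normc.normcM normc_real.
  have -> : N ('i%C : R[i]) = 1 by rewrite /Normc.normc /= expr0n /= add0r expr1n sqrtr1.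
  have -> : N (2 : R[i]) = 2 by rewrite -(rmorph_nat (real_complex R)) normc_real ger0_norm.
  by rewrite mulr1.
pose g y := pt r + (rho%:C)%C * cay y.
(* For A = 2 rho and Q = den r / (2t), the equation A L Q^2 = 9/52 forces L = 9t/26. On so short an
   arc [h y * h y'] is at most 10/9, hence the distortion factor 9/10. *)
have [||||y _ hy] := @avoid_on_arc g (2 * rho) (9 / 26 * t) (den r / (2 * t)).
- by lra.
- by apply: divr_gt0; lra.
- by rewrite /rho; field; apply/andP; split; lra.
- move=> y y' hy hy'.
  have -> : g y - g y' = (rho%:C)%C * (cay y - cay y') by rewrite /g; ring.
  rewrite Normc.normcM normc_real (ger0_norm (ltW rho0)) cayB.
  have hh : 1 <= h y * h y' <= 10 / 9.
    have sq v : 0 <= v <= 9 / 26 * t -> h v ^+ 2 <= 10 / 9 by rewrite h2; nra.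
    have a1 := h1 y; have a2 := h1 y'; have b1 := sq y hy; have b2 := sq y' hy'.
    have := sqr_ge0 (h y - h y'); nra.
  have a0 : 0 <= 2 * rho * `|y - y'| by apply: mulr_ge0; [lra|exact: normr_ge0].
  rewrite [X in _ <= X <= _](_ : _ = 2 * rho * `|y - y'| / (h y * h y')); last first.
    by field; apply/andP; split; have := h1 y; have := h1 y'; lra.
  have hh0 : 0 < h y * h y' by lra.
  apply/andP; split; last by rewrite ler_pdivrMr // ler_peMr //; case/andP: hh.
  rewrite ler_pdivlMr //.
  have : 2 * rho * `|y - y'| * (h y * h y') <= 2 * rho * `|y - y'| * (10 / 9).
    by apply: ler_wpM2l => //; lra.
  lra.
exists (g y) => //.
rewrite /g addrC addKr Normc.normcM normc_real cay1 mulr1 (ger0_norm (ltW rho0)).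
by rewrite /rho; field; lra.
Qed.

(* A point s1 that is too close to s0 has a much smaller denominator, so passing from s0
   to s1 terminates, and the displacements form a convergent geometric series. *)
Lemma descent (Q : R) s0 : Q <= den s0 ->
  exists s, [/\ Q <= den s, N (pt s0 - pt s) <= 1 / 28 / den s ^+ 2 &
    forall s', Q <= den s' -> pt s' <> pt s -> 1 / 29 <= app s' (pt s)].
Proof.
move=> Qs0.
(* The subtracted term lets the induction close: a jump costs at most [1 / 29 / den s1 ^+ 2], and
   1/29 + 1/28 * (1/29)^2 <= 1/28. *)
suff /(_ (Num.truncn (den s0)).+1 s0) : forall n s0, Q <= den s0 -> den s0 < 2 ^+ n ->
  exists s, [/\ Q <= den s,
    N (pt s0 - pt s) <= 1 / 28 / den s ^+ 2 - 1 / 28 / den s0 ^+ 2 &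
    forall s', Q <= den s' -> pt s' <> pt s -> 1 / 29 <= app s' (pt s)].
  case=> //.
    by apply: lt_trans (truncnS_gt _) _; rewrite -natrX ltr_nat ltn_expl.
  move=> s [h1 h2 h3]; exists s; split => //; apply: le_trans h2 _.
  have : 0 < den s0 ^+ 2 by rewrite exprn_gt0.
  rewrite -invr_gt0; lra.
elim=> [|n IH] {Qs0}s0 Qs0 hn; first by have := den_ge1 s0; rewrite expr0 in hn; lra.
have [good|] := pselect (forall s', Q <= den s' -> pt s' <> pt s0 -> 1 / 29 <= app s' (pt s0)).
  by exists s0; split => //; rewrite !subrr Normc.normc0.
move=> /existsNP [s1 /not_implyP [Qs1 /not_implyP [ne /negP]]]; rewrite -ltNge => bad.
have d0 := den_gt0 s0; have d1 := den_gt0 s1.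
have lt1 : den s1 < 1 / 29 * den s0.
  have := pt_sep (fun e => ne (esym e)) => sep.
  have : den s1 * 1 <= den s0 * (den s1 ^+ 2 * N (pt s0 - pt s1)).
    rewrite [leRHS](_ : _ = den s1 * (den s0 * den s1 * N (pt s0 - pt s1))); last by ring.
    by rewrite ler_pM2l.
  move=> h; have : den s0 * (den s1 ^+ 2 * N (pt s0 - pt s1)) < den s0 * (1 / 29).
    by rewrite ltr_pM2l.
  lra.
have [//||s [h1 h2 h3]] := IH s1.
  by move: hn; rewrite exprS; lra.
exists s; split => //.
apply: le_trans (normc_dist (pt s1) _ _) _.
have b1 : N (pt s0 - pt s1) <= 1 / 29 / den s1 ^+ 2.
  by rewrite ler_pdivlMr ?exprn_gt0 // mulrC ltW.
have b2 : (den s0 ^+ 2)^-1 <= (1 / 29) ^+ 2 * (den s1 ^+ 2)^-1.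
  rewrite ler_pdivlMr ?exprn_gt0 // mulrC ler_pdivrMr ?exprn_gt0 // -exprMn.
  by rewrite ler_pXn2r ?nnegrE ?ltW // mulr_gt0 //; lra.
have b3 : 0 < (den s1 ^+ 2)^-1 by rewrite invr_gt0 exprn_gt0.
lra.
Qed.

(** One round of the alternation: [x] is replaced by a point on a small circle around a fraction
    that [descent] finds near [x]. *)
Lemma circle_step x (Q d M t : R) : 0 < d -> 0 < t <= 1 / 30 ->
  (forall s, Q <= den s -> 1 / 26 <= app s x) ->
  exists r x', [/\ N (x' - x) <= d, M <= den r, app r x' = t,
    forall s, Q <= den s -> den s < den r / (2 * t) -> pt s <> pt r ->
      2 / 59 <= app s x' &
    forall s, den r / (2 * t) <= den s -> 1 / 26 <= app s x'].
Proof.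
move=> d_gt0 ht hx.
(* Here 1/364 = 1/26 - 1/28: [r] will lie within [e + 1 / 28 / den r ^+ 2] of [x], so the bound 1/26
   at [x] forces [1 / 364 <= e * den r ^+ 2]. The total displacement is then at most (1 + 364/28 +
   364/30) e < 30 e. *)
pose e := Num.min (d / 30) (1 / 364 / (M ^+ 2 + 1)).
have M1 : 0 < M ^+ 2 + 1 by have := sqr_ge0 M; lra.
have e0 : 0 < e by rewrite lt_min; apply/andP; split; apply: divr_gt0; lra.
have ed : 30 * e <= d.
  have : e <= d / 30 by rewrite ge_min lexx.
  lra.
have eM : e * M ^+ 2 < 1 / 364.
  have : e <= 1 / 364 / (M ^+ 2 + 1) by rewrite ge_min lexx orbT.
  rewrite ler_pdivlMr //; lra.
have [s0 Qs0 xs0] := pt_dense x Q e0.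
have [r [Qr rs0 rgood]] := descent Qs0.
have dr := den_gt0 r; have dr2 : 0 < den r ^+ 2 by rewrite exprn_gt0.
have xr : N (x - pt r) <= e + 1 / 28 / den r ^+ 2.
  by apply: le_trans (normc_dist (pt s0) _ _) _; exact: lerD.
have er : 1 / 364 <= e * den r ^+ 2.
  have := hx r Qr.
  have : app r x <= den r ^+ 2 * (e + 1 / 28 / den r ^+ 2) by rewrite ler_pM2l.
  have -> : den r ^+ 2 * (e + 1 / 28 / den r ^+ 2) = e * den r ^+ 2 + 1 / 28.
    by field; lra.
  lra.
have ir : (den r ^+ 2)^-1 <= 364 * e.
  by rewrite -[leLHS]mul1r ler_pdivrMr //; lra.
have [x' x'r x'good] := @avoid_on_circle r t ht.
have x'rE : N (x' - pt r) = t / den r ^+ 2 by rewrite -x'r; field; lra.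
exists r, x'; split => //.
- apply: le_trans (normc_dist (pt r) _ _) _; rewrite x'rE [N (pt r - x)]normcBC.
  have : t / den r ^+ 2 <= 1 / 30 / den r ^+ 2 by rewrite ler_pM2r ?invr_gt0 //; lra.
  lra.
- rewrite leNgt; apply/negP => lt.
  have : den r ^+ 2 < M ^+ 2 by rewrite ltr_pXn2r ?nnegrE //; lra.
  by rewrite -(ltr_pM2l e0); lra.
move=> s Qs sr ne; have ds := den_gt0 s.
(* At [pt r] the value for [s] is at least 1/29 by [descent] and at least [u] by separation; moving
   to [x'] costs at most [t * u ^+ 2]. *)
pose u := den s / den r.
have u0 : 0 < u by rewrite divr_gt0.
have ut : u * t <= 1 / 2.
  move: sr; rewrite ltr_pdivlMr; last by lra.
  by move=> h; rewrite /u mulrAC ler_pdivrMr //; lra.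
have a1 : 1 / 29 <= app s (pt r) by exact: rgood.
have a2 : u <= app s (pt r).
  rewrite /u ler_pdivrMr // normcBC.
  have := pt_sep ne; rewrite -(ler_pM2l ds) mulr1 => h; apply: le_trans h _.
  by rewrite le_eqVlt; apply/orP; left; apply/eqP; ring.
have a3 : app s (pt r) <= app s x' + t * u ^+ 2.
  have -> : t * u ^+ 2 = den s ^+ 2 * N (x' - pt r).
    by rewrite x'rE /u; field; lra.
  rewrite -mulrDr ler_pM2l ?exprn_gt0 //.
  by apply: le_trans (normc_dist x' _ _) _; rewrite addrC [N (pt r - x')]normcBC.
have [h|h] := leP u (1 / 29).
  have : t * u ^+ 2 <= 1 / 30 * (1 / 29) ^+ 2.
    by apply: ler_pM => //; rewrite ?sqr_ge0 ?ler_pXn2r ?nnegrE //; lra.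
  lra.
(* The product is the increase of v - t v^2 from v = 1/29 to v = u. *)
have : 0 <= (u - 1 / 29) * (1 - u * t - 1 / 29 * t) by apply: mulr_ge0; lra.
lra.
Qed.

Lemma dependent_choice (S : Type) (P : nat -> S -> Prop) (E : nat -> S -> S -> Prop) s0 :
  P 0%N s0 -> (forall n s, P n s -> exists2 s', P n.+1 s' & E n s s') ->
  exists u : nat -> S, forall n, P n (u n) /\ E n (u n) (u n.+1).
Proof.
move=> P0 PS.
pose next (ns : nat * S) s' := P ns.1 ns.2 -> P ns.1.+1 s' /\ E ns.1 ns.2 s'.
have [f hf] : {f & forall ns, next ns (f ns)}.
  apply: choice => -[n s]; have [/PS [s' h1 h2]|nP] := pselect (P n s); first by exists s'.
  by exists s.
pose u := fix u n := if n is n'.+1 then f (n', u n') else s0.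
have Pu n : P n (u n) by elim: n => [//|n /(hf (n, _)) []].
by exists u => n; split=> //; have [] := hf (n, u n) (Pu n).
Qed.

(** The strict positivity in the conclusion serves to show later that [x] lies outside the quadratic
    field. *)
Lemma prescribed_liminf (t : R) : 0 <= t < 1 / 30 ->
  exists x q0, [/\ 0 < q0, forall s, q0 <= den s -> t <= app s x &
    forall n, exists s, [/\ n%:R <= den s, 0 < app s x & app s x <= t + n.+1%:R^-1]].
Proof.
move=> ht.
(* The excess [i n] over [t] is positive, so that no circle degenerates even for t = 0, and at most
   1/30 - t, so that [circle_step] applies. *)
pose i n : R := (1 / 30 - t) * n.+1%:R^-1.
have c0 : 0 < 1 / 30 - t by lra.
have i0 n : 0 < i n by rewrite mulr_gt0 // invr_gt0 ltr0n.
have i1 n : i n <= 1 / 30 - t by rewrite ler_piMr ?(ltW c0) // invf_le1 ?ler1n ?ltr0n.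
have iS n : i n.+1 <= i n by rewrite ler_pM2l // lef_pV2 ?posrE ?ltr0n // ler_nat.
have iV n : i n <= n.+1%:R^-1 / 30.
  by rewrite [leRHS]mulrC ler_pM2r ?invr_gt0 ?ltr0n //; lra.
clearbody i.
pose tn n := t + i n.
have htn n : 0 < tn n <= 1 / 30 by have := i0 n; have := i1 n; rewrite /tn; lra.
(* A state holds a point, a denominator from which it is good, and a bound on the next move. The
   limit will be within [4 * e] of the point, which changes the value for denominators up to [Q] by
   at most [i n / 2]. *)
pose P n (S : R[i] * R * R) := let: (x, Q, e) := S in
  [/\ 0 < Q, 0 < e, e * Q ^+ 2 <= i n / 8 &
      forall s, Q <= den s -> 1 / 26 <= app s x].
pose E n (S S' : R[i] * R * R) := let: (x, Q, e) := S in let: (x', Q', e') := S' in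
  [/\ N (x' - x) <= e, e' <= e / 2 & exists r, [/\ n%:R <= den r, den r <= Q', app r x' = tn n &
    forall s, Q <= den s -> den s < Q' -> pt s <> pt r -> 2 / 59 <= app s x']].
have [r0 _ _] := pt_dense 0 0 ltr01.
have radius n (e Q : R) : 0 < e -> 0 < Q ->
    exists e', [/\ 0 < e', e' <= e / 2 & e' * Q ^+ 2 <= i n / 8].
  move=> e0 Q0; have Q2 : 0 < Q ^+ 2 by rewrite exprn_gt0.
  exists (Num.min (e / 2) (i n / 8 / Q ^+ 2)); split.
  - by rewrite lt_min !divr_gt0 //; lra.
  - by rewrite ge_min lexx.
  - by rewrite -ler_pdivlMr // ge_min lexx orbT.
have [x0 _ x0good] := avoid_on_circle r0 (htn 0%N).
have Qgt0 r n : 0 < den r / (2 * tn n).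
  by apply: divr_gt0; [exact: den_gt0|have := htn n; lra].
have [e0 [e0gt0 _ e0le]] := radius 0%N _ _ ltr01 (Qgt0 r0 0%N).
have [|n [[x Q] e] [Q0 egt0 ele good]|u hu] := @dependent_choice _ P E (x0, den r0 / (2 * tn 0), e0).
- by split.
- have [r [x' [h1 h2 h3 h4 h5]]] := circle_step n%:R egt0 (htn n) good.
  have [e' [e'0 e'e e'Q]] := radius n.+1 _ _ egt0 (Qgt0 r n).
  exists (x', den r / (2 * tn n), e') => //; split => //; exists r; split => //.
  rewrite ler_pdivlMr; last by have := htn n; lra.
  by rewrite -[leRHS]mulr1 ler_pM2l ?den_gt0 //; have := htn n; lra.
pose x n := (u n).1.1; pose Q n := (u n).1.2; pose e n := (u n).2.
have hP n : [/\ 0 < Q n, 0 < e n, e n * Q n ^+ 2 <= i n / 8 &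
      forall s, Q n <= den s -> 1 / 26 <= app s (x n)].
  by have := (hu n).1; rewrite /P /x /Q /e; case: (u n) => [[]].
have hE n : [/\ N (x n.+1 - x n) <= e n, e n.+1 <= e n / 2 & exists r,
    [/\ n%:R <= den r, den r <= Q n.+1, app r (x n.+1) = tn n &
    forall s, Q n <= den s -> den s < Q n.+1 -> pt s <> pt r -> 2 / 59 <= app s (x n.+1)]].
  by have := (hu n).2; rewrite /E /x /Q /e; case: (u n) (u n.+1) => [[? ?] ?] [[]].
have [z hz] : exists z, forall n, N (z - x n) <= 4 * e n.
  by apply: complex_limit => n; have [] := hE n.
have close n s : den s <= Q n.+1 ->
    app s z <= app s (x n.+1) + i n / 2 /\ app s (x n.+1) <= app s z + i n / 2.
  move=> sQ; have [Q0 egt0 ele _] := hP n.+1.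
  have b : den s ^+ 2 * N (z - x n.+1) <= i n / 2.
    have : den s ^+ 2 * N (z - x n.+1) <= Q n.+1 ^+ 2 * (4 * e n.+1).
      apply: ler_pM => //; rewrite ?sqr_ge0 ?normc_ge0 //.
      by rewrite ler_pXn2r ?nnegrE ?(ltW (den_gt0 s)) ?(ltW Q0).
    have := iS n; have := i0 n; lra.
  have ds : 0 < den s ^+ 2 by rewrite exprn_gt0 ?den_gt0.
  split.
    apply: le_trans (_ : _ <= den s ^+ 2 * (N (z - x n.+1) + N (x n.+1 - pt s))) _.
      by rewrite ler_pM2l //; exact: normc_dist.
    by rewrite mulrDr; lra.
  apply: le_trans (_ : _ <= den s ^+ 2 * (N (x n.+1 - z) + N (z - pt s))) _.
    by rewrite ler_pM2l //; exact: normc_dist.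
  by rewrite mulrDr [N (_ - z)]normcBC; lra.
exists z, (Q 0%N); split; first by have [] := hP 0%N.
  move=> s Qs.
  have [k hk] : exists k, den s < Q k.
    exists (Num.truncn (den s)).+2; apply: lt_le_trans (truncnS_gt _) _.
    by have [_ _ [r [h1 h2 _ _]]] := hE (Num.truncn (den s)).+1; exact: le_trans h1 h2.
  have [n nx nmin] := ex_minnP (ex_intro (fun k => den s < Q k) k hk).
  case: n nx nmin => [|n] nx nmin; first by move: nx; rewrite ltNge Qs.
  have Qn : Q n <= den s by rewrite leNgt; apply/negP => /nmin; rewrite ltnn.
  have [_ _ [r [h1 h2 h3 h4]]] := hE n; have [_ cl] := close n s (ltW nx).
  have in0 := i0 n; have in1 := i1 n.
  (* Points other than the centre keep 2/59 - [i n / 2] > t, since 2/59 > 1/30 and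
     [i n <= 1 / 30 - t]; the centre keeps t + [i n / 2]. *)
  have [er|ne] := pselect (pt s = pt r); last by have := h4 s Qn nx ne; lra.
  by move: cl; rewrite (den_uniq er) er h3 /tn; lra.
move=> n; have [_ _ [r [h1 h2 h3 h4]]] := hE n; have [c1 c2] := close n r h2.
exists r; split => //; move: c1 c2; rewrite h3 /tn; move: (i0 n) (iV n).
  lra.
by move: (n.+1%:R^-1) => v; lra.
Qed.

End SeparatedFamily.

(** * Discreteness and cocompactness of an order *)

Section ImaginaryQuadraticOrder.
Variables (R : realType) (m : nat) (O I : set R[i]).
Hypotheses (m_gt0 : (0 < m)%N) (O_order : is_order R m O) (I_ideal : is_ideal R O I).

Local Notation w := (isqrt R m).

(** For [D > 0] this is the lattice (1/D) Z[i sqrt m], which is discrete. *)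
Definition has_denominator (D : nat) (z : R[i]) :=
  exists a b : int, D%:R * z = a%:~R + b%:~R * w.

Lemma intrC (a : int) : a%:~R = ((a%:~R : R)%:C)%C.
Proof. by rewrite -(rmorph_int (real_complex R)). Qed.

Lemma isqrt_sqr : w * w = - m%:R.
Proof.
rewrite /isqrt; apply/eqP; rewrite eq_complex /= !mul0r !mulr0 add0r addr0 -expr2.
rewrite sqr_sqrtr ?ler0n // -(rmorph_nat (real_complex R)) /=.
by rewrite !eqxx oppr0 eqxx.
Qed.

Lemma denominator_mul D D' z z' : has_denominator D z -> has_denominator D' z' ->
  has_denominator (D * D') (z * z').
Proof.
move=> [a [b ab]] [c [d cd]].
exists (a * c - b * d * m%:Z), (a * d + b * c).
rewrite natrM mulrACA ab cd !rmorphD rmorphN /= !rmorphM /= -pmulrn.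
have -> : m%:R = - (w * w) by rewrite isqrt_sqr opprK.
ring.
Qed.

Lemma denominator_sub D D' z z' : has_denominator D z -> has_denominator D' z' ->
  has_denominator (D * D') (z - z').
Proof.
move=> [a [b ab]] [c [d cd]].
exists (a * D'%:Z - c * D%:Z), (b * D'%:Z - d * D%:Z).
have -> : (D * D')%:R * (z - z') = (D%:R * z) * D'%:R - (D'%:R * z') * D%:R.
  by rewrite natrM; ring.
by rewrite ab cd !rmorphB /= !rmorphM /= -!pmulrn; ring.
Qed.

Lemma rat_denominator (q : rat) : exists2 D, (0 < D)%N &
  exists a : int, D%:R * ratr q = a%:~R :> R[i].
Proof.
exists `|denq q|%N; first by rewrite absz_gt0 denq_neq0.
exists (numq q).
have -> : `|denq q|%N%:R = (denq q)%:~R :> R[i].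
  by rewrite [in RHS](_ : denq q = `|denq q|%N) ?pmulrn // gez0_abs // ltW // denq_gt0.
by rewrite /ratr mulrC divfK // intr_eq0 denq_neq0.
Qed.

Lemma QF_denominator z : QF R m z -> exists2 D, (0 < D)%N & has_denominator D z.
Proof.
move=> [p [q ->]].
have [D D0 [a ha]] := rat_denominator p; have [D' D0' [b hb]] := rat_denominator q.
exists (D * D')%N; first by rewrite muln_gt0 D0.
exists (a * D'%:Z), (b * D%:Z).
rewrite natrM mulrDr !(rmorphM intr) /= -!pmulrn -ha -hb; ring.
Qed.

(** For a nonzero a + b i sqrt m, the real part has modulus at least 1 if b = 0, and the imaginary
    part does otherwise. *)
Lemma denominator_norm D z : has_denominator D z -> (0 < D)%N -> z != 0 -> 1 <= D%:R * N z.
Proof.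
move=> [a [b ab]] D0 z0.
have -> : D%:R * N z = N (D%:R * z).
  rewrite Normc.normcM; congr (_ * _).
  by rewrite -(rmorph_nat (real_complex R)) normc_real ger0_norm.
have nz : D%:R * z != 0 by rewrite mulf_neq0 // pnatr_eq0 -lt0n.
have int1 (k : int) : k != 0 -> 1 <= `|k%:~R : R|.
  by move=> k0; rewrite -intr_norm -[1](rmorph1 intr) ler_int -gtz0_ge1 normr_gt0.
rewrite ab in nz *.
have Eab : a%:~R + b%:~R * w = (a%:~R +i* (b%:~R * Num.sqrt m%:R))%C :> R[i].
  by rewrite !intrC /isqrt; simpc.
have [b0|b0] := eqVneq b 0.
  apply: le_trans (normc_ge_absRe _); rewrite Eab /= int1 //.
  by apply: contraNneq nz => ->; rewrite b0 mul0r addr0.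
apply: le_trans (normc_ge_absIm _); rewrite Eab /= normrM.
rewrite -[leLHS]mulr1; apply: ler_pM => //; first exact: int1.
by rewrite ger0_norm ?sqrtr_ge0 // -[leLHS]sqrtr1 ler_wsqrtr // ler1n.
Qed.

Lemma order_denominator : exists2 D, (0 < D)%N & forall z, O z -> has_denominator D z.
Proof.
case: O_order => OK _ _ _ [e1 [e2 [OE _]]].
have Oe1 : O e1 by apply/OE; exists 1, 0; rewrite mul1r mul0r addr0.
have Oe2 : O e2 by apply/OE; exists 0, 1; rewrite mul1r mul0r add0r.
have [D1 D10 [a1 [b1 h1]]] := QF_denominator (OK _ Oe1).1.
have [D2 D20 [a2 [b2 h2]]] := QF_denominator (OK _ Oe2).1.
exists (D1 * D2)%N; first by rewrite muln_gt0 D10.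
move=> z /OE [a [b ->]].
exists (a * D2%:Z * a1 + b * D1%:Z * a2), (a * D2%:Z * b1 + b * D1%:Z * b2).
have -> : (D1 * D2)%:R * (a%:~R * e1 + b%:~R * e2) =
    a%:~R * D2%:R * (D1%:R * e1) + b%:~R * D1%:R * (D2%:R * e2).
  by rewrite natrM; ring.
by rewrite h1 h2 !rmorphD /= !rmorphM /= -!pmulrn; ring.
Qed.

Let O1 : O 1. Proof. by case: O_order. Qed.
Let OB x y : O x -> O y -> O (x - y). Proof. by case: O_order => _ _ h _ _; exact: h. Qed.
Let OM x y : O x -> O y -> O (x * y). Proof. by case: O_order => _ _ _ h _; exact: h. Qed.
Let O0 : O 0. Proof. by rewrite -(subrr 1); exact: OB. Qed.
Let ON x : O x -> O (- x). Proof. by move=> Ox; rewrite -sub0r; exact: OB. Qed.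
Let OD x y : O x -> O y -> O (x + y).
Proof. by move=> Ox Oy; rewrite -[y]opprK; apply: OB => //; exact: ON. Qed.
Let OX x n : O x -> O (x ^+ n).
Proof. by move=> Ox; elim: n => [//|n IH]; rewrite exprS; exact: OM. Qed.
Let OZ (a : int) x : O x -> O (a%:~R * x).
Proof.
case: O_order => _ _ _ _ [e1 [e2 [OE _]]] /OE [b [c ->]]; apply/OE.
by exists (a * b), (a * c); rewrite !rmorphM /=; ring.
Qed.

(* Otherwise the powers of z would accumulate at 0 in a discrete set. *)
Lemma order_norm_ge1 z : O z -> z != 0 -> 1 <= N z.
Proof.
move=> Oz z0; have [D D0 hD] := order_denominator.
have c0 : 0 < N z by rewrite normc_gt0.
rewrite leNgt; apply/negP => c1.
(* By Bernoulli, the powers of 1/|z| = 1 + e exceed D once n > D / e. *)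
pose e := (N z)^-1 - 1.
have e0 : 0 < e by rewrite subr_gt0 invf_gt1.
have bern n : 1 + n%:R * e <= (N z)^-1 ^+ n.
  elim: n => [|n IH]; first by rewrite mul0r addr0 expr0.
  rewrite exprS -[(N z)^-1](subrK 1) -/e.
  have : (e + 1) * (1 + n%:R * e) <= (e + 1) * (e + 1) ^+ n.
    by rewrite ler_pM2l //; [rewrite [e + 1](subrK 1)|lra].
  apply: le_trans; rewrite -natr1.
  have : 0 <= n%:R * e * e by rewrite !mulr_ge0 // ltW.
  lra.
pose n := (Num.truncn (D%:R / e)).+1.
have := denominator_norm (hD _ (OX n Oz)) D0 (expf_neq0 n z0).
rewrite normcX -ler_pdivrMr ?exprn_gt0 // mul1r -exprVn => h.
have := bern n; have : D%:R < n%:R * e by rewrite -ltr_pdivrMr //; exact: truncnS_gt.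
lra.
Qed.

(** Real elements of [O] have integer multiples by [D], so two real generators would be linearly
    dependent over the integers. *)
Lemma order_nonreal : exists2 z, O z & complex.Im z != 0.
Proof.
case: O_order => _ _ _ _ [e1 [e2 [OE free]]].
have Oe1 : O e1 by apply/OE; exists 1, 0; rewrite mul1r mul0r addr0.
have Oe2 : O e2 by apply/OE; exists 0, 1; rewrite mul1r mul0r add0r.
have [i1|] := eqVneq (complex.Im e1) 0; last by exists e1.
have [i2|] := eqVneq (complex.Im e2) 0; last by exists e2.
exfalso; have [D D0 hD] := order_denominator.
have D0R : D%:R != 0 :> R[i] by rewrite pnatr_eq0 -lt0n.
have realE z : O z -> complex.Im z = 0 -> exists a : int, D%:R * z = a%:~R.
  move=> /hD [a [b ab]] iz; exists a; rewrite ab.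
  suff -> : b = 0 by rewrite mul0r addr0.
  move/(congr1 (@complex.Im R)): ab.
  rewrite !intrC /isqrt -(rmorph_nat (real_complex R)).
  case: z iz => x y /= ->; rewrite !(mul0r, mulr0, add0r, addr0) => /esym/eqP.
  rewrite mulf_eq0 intr_eq0 => /orP [/eqP //|].
  by rewrite sqrtr_eq0 lern0 => /eqP m0; move: m_gt0; rewrite m0.
have [a1 h1] := realE _ Oe1 i1; have [a2 h2] := realE _ Oe2 i2.
have [a20 /eqP] : a2 = 0 /\ - a1 = 0.
  apply: free; apply: (mulfI D0R); rewrite mulr0 mulrDr mulrCA h1 mulrCA h2.
  by rewrite rmorphN /=; ring.
rewrite oppr_eq0 => /eqP a10.
have [] // : (1 : int) = 0 /\ (0 : int) = 0.
apply: free; rewrite mul0r addr0 mul1r; apply: (mulfI D0R).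
by rewrite h1 a10 mulr0.
Qed.

Lemma order_cocompact : exists C : R, forall z, exists2 v, O v & N (z - v) <= C.
Proof.
have [[c d] Oe /= d0] := order_nonreal.
exists (1 + `|d|) => -[x y].
pose b := Num.floor (y / d); pose a := Num.floor (x - b%:~R * c).
exists (a%:~R * 1 + b%:~R * (c +i* d)%C).
  by apply: OD; exact: OZ.
apply: le_trans (normc_le_ReIm _) _.
have -> : (x +i* y)%C - (a%:~R * 1 + b%:~R * (c +i* d)%C) =
    ((x - b%:~R * c - a%:~R) +i* (y - b%:~R * d))%C.
  rewrite !intrC mulr1; apply/eqP; rewrite eq_complex /=; apply/andP; split; apply/eqP; ring.
have fl (v : R) : `|v - (Num.floor v)%:~R| <= 1.
  have := floor_le v.
  have := floorD1_gt v; rewrite rmorphD /= => h1 h2.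
  by rewrite ger0_norm; lra.
apply: lerD => /=; first exact: fl.
have -> : y - b%:~R * d = (y / d - b%:~R) * d by field.
by rewrite normrM ler_piMl.
Qed.

(** * Reduced fractions with denominator in the ideal: coprimality, separation, density *)

Definition fraction (pq : R[i] * R[i]) :=
  [/\ O pq.1, I pq.2, gen_whole R O pq.1 pq.2 & pq.2 != 0].

Lemma ideal_sub x : I x -> O x.
Proof. by case: I_ideal => h _ _ _; exact: h. Qed.

Lemma gen_whole1 p q : O p -> I q ->
  (exists u v, [/\ O u, O v & u * p + v * q = 1]) -> gen_whole R O p q.
Proof.
move=> Op /ideal_sub Oq [u [v [Ou Ov uv]]] z; split.
  move=> Oz; exists (z * u), (z * v); split; [exact: OM|split; first exact: OM].
  by rewrite -!mulrA -mulrDr uv mulr1.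
by move=> [u' [v' [Ou' [Ov' ->]]]]; apply: OD; exact: OM.
Qed.

(** Modulo 1 + x v the element x is invertible, with inverse -v. *)
Lemma bezout_power x v n : O x -> O v ->
  exists u1 u2, [/\ O u1, O u2 & u1 * (1 + x * v) + u2 * x ^+ n = 1].
Proof.
move=> Ox Ov; elim: n => [|n [u1 [u2 [O1' O2 e]]]].
  by exists 0, 1; split=> //; rewrite mul0r add0r mulr1.
exists (u1 + u2 * x ^+ n), (- (u2 * v)); split.
- by apply: OD => //; apply: OM => //; exact: OX.
- by apply: ON; exact: OM.
by rewrite -[RHS]e exprS; ring.
Qed.

Lemma fraction_sep s s' : fraction s -> fraction s' -> s.1 / s.2 <> s'.1 / s'.2 ->
  1 <= N s.2 * N s'.2 * N (s.1 / s.2 - s'.1 / s'.2).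
Proof.
move: s s' => [p q] [p' q'] [/= Op Iq _ q0] [/= Op' Iq' _ q'0] ne.
rewrite -!Normc.normcM (_ : q * q' * _ = p * q' - p' * q); last first.
  by field; rewrite q0 q'0.
apply: order_norm_ge1; first by apply: OB; apply: OM => //; exact: ideal_sub.
by apply: contra_notN ne; rewrite subr_eq0 -eqr_div // => /eqP.
Qed.

(** From u p + v q = 1 and p q' = p' q follows q' = q (u p' + v q'), so q divides q' in [O]. *)
Lemma fraction_den_le s s' : fraction s -> fraction s' -> s.1 / s.2 = s'.1 / s'.2 ->
  N s.2 <= N s'.2.
Proof.
move: s s' => [p q] [p' q'] [/= Op /ideal_sub Oq g q0] [/= Op' /ideal_sub Oq' _ q'0].
move=> /eqP; rewrite eqr_div // => /eqP e.
have [u [v [Ou [Ov uv]]]] := (g 1).1 O1.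
have q'E : q' = q * (u * p' + v * q').
  by rewrite -[LHS]mul1r uv mulrDl mulrDr -mulrA e; ring.
rewrite [in leRHS]q'E Normc.normcM ler_peMr ?normc_ge0 //.
apply: order_norm_ge1; first by apply: OD; exact: OM.
by apply: contra_neq q'0 => k0; rewrite q'E k0 mulr0.
Qed.

(* The fractions (1 + a v) / a ^ n.+1 with v in O form a coset of the lattice
   O / a ^ n inside the family. *)
Lemma fraction_dense x (d q : R) : (exists z, I z /\ z <> 0) -> 0 < d ->
  exists s, [/\ fraction s, q <= N s.2 & N (x - s.1 / s.2) <= d].
Proof.
move=> [z [Iz /eqP z0]] d0; case: (I_ideal) => _ _ ID IM.
(* Doubling gives modulus at least 2 within the ideal, so that the powers of [a] grow. *)
pose a := z + z.
have Ia : I a by exact: ID.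
have a2 : 2 <= N a.
  rewrite (_ : a = ((2 : R)%:C)%C * z) ?Normc.normcM ?normc_real.
    rewrite ger0_norm // ler_peMr //; apply: order_norm_ge1 => //; exact: ideal_sub.
  by rewrite (rmorph_nat (real_complex R)) /a; ring.
have a0 : a != 0 by rewrite -normc_gt0; lra.
have [C hC] := order_cocompact.
pose n := (Num.truncn (Num.max (C / d) q)).+1.
have : Num.max (C / d) q < N (a ^+ n).
  apply: lt_le_trans (truncnS_gt _) _; rewrite normcX.
  apply: (@le_trans _ _ (2 ^+ n)); last by rewrite lerXn2r ?nnegrE //; lra.
  by rewrite -natrX ler_nat ltnW // ltn_expl.
rewrite gt_max => /andP [Cn qn].
have [v Ov hv] := hC (x * a ^+ n - a^-1).
have Oa := ideal_sub Ia.
have Ian : I (a ^+ n.+1) by rewrite exprSr; apply: IM => //; exact: OX.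
exists (1 + a * v, a ^+ n.+1); split => /=.
- split => //=; first by apply: OD => //; exact: OM.
    by apply: gen_whole1 => //; [apply: OD => //; exact: OM|exact: bezout_power].
  by rewrite expf_neq0.
- rewrite exprS Normc.normcM; apply: le_trans (ltW qn) _.
  by rewrite ler_peMl ?normc_ge0 //; lra.
have an0 : a ^+ n != 0 by rewrite expf_neq0.
have -> : x - (1 + a * v) / a ^+ n.+1 = (x * a ^+ n - a^-1 - v) / a ^+ n.
  by rewrite exprS; field; rewrite an0.
have nan : 0 < N (a ^+ n) by rewrite normc_gt0.
rewrite Normc.normcM Normc.normcV ler_pdivrMr //; apply: le_trans hv _.
by rewrite mulrC -ler_pdivrMr // ltW.
Qed.

(** If x were in the field, q x - p would have a fixed denominator F, hence modulus at least 1/F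
    when nonzero, and |q| |q x - p| would be unbounded. *)
Lemma not_QF x (B : R) :
  (forall n : nat, exists s, [/\ fraction s, n%:R <= N s.2,
     0 < N s.2 ^+ 2 * N (x - s.1 / s.2) & N s.2 ^+ 2 * N (x - s.1 / s.2) <= B]) ->
  ~ QF R m x.
Proof.
move=> hx /QF_denominator [D D0 xD].
have [E E0 OE] := order_denominator.
pose F := (E * D * E)%N.
have F0 : (0 < F)%N by rewrite !muln_gt0 E0 D0.
have [[p q] [/= [/= Op Iq _ q0] qn lo up]] := hx (Num.truncn (F%:R * B)).+1.
have dF : has_denominator F (q * x - p).
  apply: denominator_sub; last exact: OE.
  by apply: denominator_mul => //; apply: OE; exact: ideal_sub.
have e : N q ^+ 2 * N (x - p / q) = N q * N (q * x - p).
  rewrite expr2 -mulrA -Normc.normcM; congr (_ * N _); by field.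
have ne : q * x - p != 0.
  by apply: contraTneq lo => h; rewrite e h Normc.normc0 mulr0 ltxx.
have h1 := denominator_norm dF F0 ne.
have q1 : 0 < N q by rewrite normc_gt0.
have h2 : N q <= F%:R * B.
  apply: le_trans (_ : _ <= N q * (F%:R * N (q * x - p))) _; first by rewrite ler_peMr // ltW.
  by rewrite mulrCA -e ler_pM2l // ltr0n.
have := truncnS_gt (F%:R * B); lra.
Qed.

(** * Evaluation of the liminf and the interval in the spectrum *)

Lemma lag_cE x (t q0 : R) : 0 < q0 ->
  (forall s, fraction s -> q0 <= N s.2 -> t <= N s.2 ^+ 2 * N (x - s.1 / s.2)) ->
  (forall n : nat, exists s, [/\ fraction s, n%:R <= N s.2 &
     N s.2 ^+ 2 * N (x - s.1 / s.2) <= t + n.+1%:R^-1]) ->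
  lag_c R O I x = t%:E.
Proof.
move=> q00 lo up; apply/eqP; rewrite eq_le; apply/andP; split.
  apply/ereal_supP => _ [r _ <-]; apply/lee_addgt0Pr => e e0.
  pose n := Num.truncn (Num.max r e^-1).
  have : Num.max r e^-1 < n.+1%:R by exact: truncnS_gt.
  rewrite gt_max => /andP [rn en].
  have [[p q] [[/= Op Iq g q0'] qn h]] := up n.+1.
  apply: (@le_trans _ _ (N q ^+ 2 * N (x - p / q))%:E).
    by apply: ereal_inf_lbound; exists p, q; split => //; rewrite (le_trans (ltW rn)).
  rewrite -EFinD lee_fin; apply: le_trans h _; rewrite lerD2l.
  rewrite invf_ple ?posrE ?ltr0n //; apply: le_trans (ltW en) _.
  by rewrite ler_nat.
apply: le_trans (_ : _ <= ereal_inf _)%E _; last first.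
  by apply: ereal_sup_ubound; exists q0.
apply/ereal_infP => _ [p [q [Op Iq g qq ->]]]; rewrite lee_fin.
apply: (lo (p, q)) => //; split => //=.
by rewrite -normc_gt0; exact: lt_le_trans qq.
Qed.

End ImaginaryQuadraticOrder.

Unset Implicit Arguments.

Theorem theorem1p7 (R : realType) (m : nat) (O I : set R[i]) :
  (0 < m)%N -> squarefree m -> is_order R m O -> is_ideal R O I ->
  (exists z, I z /\ z <> 0) ->
  [set t : R | 0 <= t <= 33 / 1000] `<=` SpLag R m O I.
Proof.
move=> m0 _ hO hI Inz t /= ht.
(* [prescribed_liminf] covers all t below 1/30 > 0.033. *)
have {}ht : 0 <= t < 1 / 30 by lra.
pose pt (s : {s | fraction O I s}) := (sval s).1 / (sval s).2.
pose den (s : {s | fraction O I s}) := N (sval s).2.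
have [|[s hs] [s' hs']||y d q d0|x [q0 [q00 lo up]]] := @prescribed_liminf R _ pt den _ _ _ _ t ht.
- move=> [s hs]; have [_ Iq _ q0] := hs; apply: (order_norm_ge1 m0 hO) => //.
  exact: (ideal_sub hI).
- exact: (fraction_sep m0 hO hI).
- move=> [s hs] [s' hs'] e; apply/eqP; rewrite eq_le.
  by rewrite !(fraction_den_le m0 hO hI).
- have [s [hs h1 h2]] := fraction_dense m0 hO hI y q Inz d0.
  by exists (exist _ s hs).
exists x; split.
  apply: (@not_QF R m O I m0 hO hI x (t + 1)) => n.
  have [[s hs] [h1 h2 h3]] := up n; exists s; split => //.
  by apply: le_trans h3 _; rewrite lerD2l invf_le1 ?ler1n ?ltr0n.
apply: (lag_cE q00) => [s hs|n]; first exact: (lo (exist _ s hs)).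
by have [[s hs] [h1 h2 h3]] := up n; exists s.
Qed.
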